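(* Let $n\ge 1$ and let $S$ be a subsemigroup of the partial transformation semigroup $PT_n$. Suppose that $S$ is not a group and that $r(S)\le n-1$. Then $$N'(S)\ \ge\ \left\lceil \frac{n-t(S)}{n-r(S)}\right\rceil .$$
   Context: $PT_n$ is the semigroup, under composition (functions act on the right), of all partial functions from $X_n=\{1,\dots,n\}$ to itself; the rank of $f\in PT_n$ is the cardinality of its image. All semigroups are finite and non-empty. A generating set of a semigroup $S$ is a non-empty subset $A\subseteq S$ such that every element of $S$ is a product of one or more elements of $A$; it is minimal if no proper subset of $A$ is a generating set of $S$. For a generating set $A$ and $s\in S$, the length $l_A(s)$ is the least $k$ such that $s=a_1\cdots a_k$ with $a_i\in A$, except that the identity element of $S$ (if there is one) has length $0$ by convention. The kernel $\ker(S)$ is the minimum (two-sided) ideal of $S$; $N(S,A)=\min\{l_A(s): s\in\ker(S)\}$; and $N'(S)=\min\{N(S,A): A \text{ a minimal generating set of } S\}$. For $S\le PT_n$, $t(S)$ denotes the (common) rank of the elements of $\ker(S)$, and $r(S)$ denotes the minimum of the ranks of the elements of $A$, where $A$ is a minimal generating set of $S$ (this number does not depend on the choice of the minimal generating set $A$). *)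

(* Defs.v *)
From HB Require Import structures.
From mathcomp Require Import all_boot.
From mathcomp Require Import boolp.

Set Implicit Arguments.
Unset Strict Implicit.
Unset Printing Implicit Defensive.

(* The minimum of a set of natural numbers; 0 is a junk value, taken only on
   the empty set. *)
Definition least (P : nat -> Prop) : nat :=
  if pselect (exists k, `[< P k >]) is left exP then ex_minn exP else 0.

Lemma leastP (P : nat -> Prop) :
  (exists k, P k) -> P (least P) /\ forall k, P k -> least P <= k.
Proof.
move=> [k0 Pk0]; rewrite /least; case: pselect => [exP|nexP]; last first.
  by case: nexP; exists k0; apply/asboolP.
case: ex_minnP => m /asboolP Pm minm; split=> // k Pk.
by apply: minm; apply/asboolP.
Qed.

(* The index set X_n = {1, ..., n} is represented by 'I_n, and None stands for
   "undefined". *)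
Definition PT (n : nat) : Type := {ffun 'I_n -> option 'I_n}.

HB.instance Definition _ n := Finite.on (PT n).

Section PartialTransformations.
Context (n : nat).
Implicit Types f g h : PT n.

(* Functions act on the right: f * g applies f first. *)
Definition PT_mul f g : PT n := [ffun x => obind g (f x)].

Definition PT_one : PT n := [ffun x => Some x].

Fact PT_mulA : associative PT_mul.
Proof.
by move=> f g h; apply/ffunP=> x; rewrite !ffunE; case: (f x) => //= y; rewrite ffunE.
Qed.

Fact PT_mul1f : left_id PT_one PT_mul.
Proof. by move=> f; apply/ffunP=> x; rewrite !ffunE. Qed.

Fact PT_mulf1 : right_id PT_one PT_mul.
Proof. by move=> f; apply/ffunP=> x; rewrite !ffunE; case: (f x) => //= y; rewrite ffunE. Qed.

HB.instance Definition _ := isMonoid.Build (PT n) PT_mulA PT_mul1f PT_mulf1.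

Definition rank f : nat := #|[set y : 'I_n | [exists x, f x == Some y]]|.

End PartialTransformations.

Section Semigroups.
Context (n : nat).
Implicit Types (S A I : {set PT n}) (s e : PT n).
Local Open Scope group_scope.

Definition subsemigroup S : Prop :=
  S != set0 /\ {in S &, forall s t, s * t \in S}.

Definition is_identity S e : Prop :=
  e \in S /\ {in S, forall s, e * s = s /\ s * e = s}.

(* S is a group in the abstract sense: its identity need not be that of PT n. *)
Definition is_group S : Prop :=
  subsemigroup S /\
  exists2 e, is_identity S e &
    {in S, forall s, exists2 t, t \in S & s * t = e /\ t * s = e}.

Definition is_product A (k : nat) s : Prop :=
  exists2 w : k.-tuple (PT n), {subset w <= A} & s = \prod_(a <- w) a.

Definition generating S A : Prop :=
  [/\ A != set0, A \subset S &
      {in S, forall s, exists2 k, 0 < k & is_product A k s}].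

Definition minimal_generating S A : Prop :=
  generating S A /\ forall B : {set PT n}, B \proper A -> ~ generating S B.

Definition length S A s : nat :=
  least (fun k => if `[< is_identity S s >] then k = 0
                  else 0 < k /\ is_product A k s).

Definition ideal S I : Prop :=
  [/\ I != set0, I \subset S &
      {in I & S, forall i s, i * s \in I /\ s * i \in I}].

(* The intersection of all ideals; kernel_ideal and kernel_min below show that
   it is the minimum ideal. *)
Definition kernel S : {set PT n} :=
  \bigcap_(I : {set PT n} | `[< ideal S I >]) I.

Definition N S A : nat :=
  least (fun k => exists2 s, s \in kernel S & length S A s = k).

Definition N' S : nat :=
  least (fun k => exists2 A, minimal_generating S A & N S A = k).

Definition min_rank A : nat :=
  least (fun k => exists2 a, a \in A & rank a = k).

(* t and r pick the unique element of a singleton set of ranks: see rank_kernel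
   and min_rank_r below. *)
Definition t S : nat :=
  least (fun k => exists2 s, s \in kernel S & rank s = k).

Definition r S : nat :=
  least (fun k => exists2 A, minimal_generating S A & min_rank A = k).

End Semigroups.

Section WellDefined.
Context (n : nat).
Implicit Types (S A B I J : {set PT n}) (s f g : PT n).
Local Open Scope group_scope.

Lemma rank_mulr f g : rank (f * g) <= rank g.
Proof.
apply/subset_leq_card/subsetP=> y; rewrite !inE => /existsP[x].
rewrite ffunE; case: (f x) => //= z gz; by apply/existsP; exists z.
Qed.

Lemma rank_mull f g : rank (f * g) <= rank f.
Proof.
rewrite /rank.
pose im := [set y : 'I_n | [exists x, f x == Some y]].
pose G := [set Some y | y in [set y : 'I_n | [exists x, (f * g) x == Some y]]].
have <- : #|G| = #|[set y : 'I_n | [exists x, (f * g) x == Some y]]|.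
  by apply: card_imset => a b [].
apply: (@leq_trans #|(g : 'I_n -> option 'I_n) @: im|); last exact: leq_imset_card.
apply/subset_leq_card/subsetP=> z /imsetP[y]; rewrite inE => /existsP[x].
rewrite ffunE; case fx: (f x) => [u|] //= /eqP gu ->.
by rewrite -gu; apply: imset_f; rewrite inE; apply/existsP; exists x; rewrite fx.
Qed.

Lemma kernel_min S I : ideal S I -> kernel S \subset I.
Proof. by move=> idI; apply: bigcap_inf; apply/asboolP. Qed.

Lemma ideal_full S : subsemigroup S -> ideal S S.
Proof. by move=> [S0 Sm]; split=> // i s Si Ss; split; apply: Sm. Qed.

Lemma idealI S I J : ideal S I -> ideal S J -> ideal S (I :&: J).
Proof.
move=> [/set0Pn[i Ii] IS Im] [/set0Pn[j Jj] JS Jm]; split.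
- apply/set0Pn; exists (i * j); rewrite inE.
  have [-> _] := Im i j Ii (subsetP JS _ Jj).
  by have [_ ->] := Jm j i Jj (subsetP IS _ Ii).
- by apply: subset_trans IS; apply: subsetIl.
move=> k s; rewrite inE => /andP[Ik Jk] Ss; rewrite !inE.
by have [-> ->] := Im _ _ Ik Ss; have [-> ->] := Jm _ _ Jk Ss.
Qed.

Lemma kernel_ideal S : subsemigroup S -> ideal S (kernel S).
Proof.
move=> sS.
have kS : kernel S = S :&: kernel S.
  by apply/esym/setIidPr/kernel_min/ideal_full.
rewrite kS /kernel; elim/big_rec: _ => [|I J /asboolP idI idJ].
  by rewrite setIT; apply: ideal_full.
by rewrite setICA; apply: idealI.
Qed.

Lemma rank_kernel S s : subsemigroup S -> s \in kernel S -> rank s = t S.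
Proof.
move=> sS; have [_ _ Km] := kernel_ideal sS; have [_ Sm] := sS.
have KS : {subset kernel S <= S} by apply/subsetP/kernel_min/ideal_full.
have rk_le : {in kernel S &, forall x y, rank x <= rank y}.
  move=> x y Kx Ky; have := KS _ Kx; have := KS _ Ky => Sy Sx.
  pose I := [set u in S | rank u <= rank y].
  have idI : ideal S I.
    split; first by apply/set0Pn; exists y; rewrite inE Sy leqnn.
      by apply/subsetP=> u; rewrite inE => /andP[].
    move=> u v; rewrite !inE => /andP[Su ru] Sv; rewrite !Sm //=.
    by split; apply: leq_trans ru; [apply: rank_mull|apply: rank_mulr].
  by have := subsetP (kernel_min idI) _ Kx; rewrite inE => /andP[].
move=> Ks; have [|[u Ku ru] _] := @leastP (fun k => exists2 u, u \in kernel S & rank u = k).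
  by exists (rank s), s.
rewrite /t -ru.
by apply/eqP; rewrite eqn_leq !rk_le.
Qed.

Lemma minimal_generating_exists S :
  subsemigroup S -> exists A, minimal_generating S A.
Proof.
move=> [S0 Sm].
have genS : `[< generating S S >].
  apply/asboolP; split=> // s Ss; exists 1%N => //; exists [tuple s] => //.
    by move=> a; rewrite inE => /eqP->.
  by rewrite big_seq1.
have [A /minsetP[/asboolP gA minA] _] :=
  minset_exists (P := fun A => `[< generating S A >]) genS.
exists A; split=> // B BA gB.
have := minA B (introT (asboolP _) gB) (proper_sub BA) => eBA.
by move: BA; rewrite eBA properxx.
Qed.

Lemma min_rankP A : A != set0 ->
  (exists2 a, a \in A & rank a = min_rank A) /\ {in A, forall a, min_rank A <= rank a}.
Proof.
move=> /set0Pn[a Aa].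
have [|ex mn] := @leastP (fun k => exists2 a, a \in A & rank a = k).
  by exists (rank a), a.
by split=> // b Ab; apply: mn; exists b.
Qed.

Lemma rank_prod (w : seq (PT n)) f : f \in w -> rank (\prod_(a <- w) a) <= rank f.
Proof.
elim: w => // a w IH; rewrite big_cons inE => /orP[/eqP->|/IH]; first exact: rank_mull.
exact: leq_trans (rank_mulr _ _).
Qed.

Lemma is_product_trans A B k s :
  {in B, forall b, exists2 j, 0 < j & is_product A j b} ->
  0 < k -> is_product B k s -> exists2 j, 0 < j & is_product A j s.
Proof.
move=> BA k0 [w wB ->].
suff [v [vA ->] v0] : exists2 v : seq (PT n),
    {subset v <= A} /\ \prod_(a <- w) a = \prod_(a <- v) a & size w <= size v.
  by exists (size v); [rewrite (leq_trans k0)// -(size_tuple w)|exists (in_tuple v)].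
have: {subset tval w <= B} := wB.
elim: (tval w) => [|b u IH] {}wB; first by exists [::].
have [|v [vA e] v0] := IH; first by move=> x ux; apply: wB; rewrite in_cons ux orbT.
have [j j0 [x xA bE]] := BA b (wB b (mem_head _ _)).
exists (x ++ v); last by rewrite size_cat size_tuple /= -add1n leq_add.
split; first by move=> y; rewrite mem_cat => /orP[/xA|/vA].
by rewrite big_cons big_cat /= -bE e.
Qed.

Lemma min_rank_le S A B :
  minimal_generating S A -> generating S B -> min_rank B <= min_rank A.
Proof.
move=> [[A0 AS genA] minA] [B0 BS genB].
have [[a Aa <-] _] := min_rankP A0.
have [_ Bmin] := min_rankP B0.
rewrite leqNgt; apply/negP=> lt_aB.
have BA : {in B, forall b, exists2 j, 0 < j & is_product (A :\ a) j b}.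
  move=> b Bb; have [k k0 [w wA bE]] := genA b (subsetP BS _ Bb).
  exists k => //; exists w => // x wx; rewrite !inE wA // andbT.
  apply/eqP=> xa; have := rank_prod wx; rewrite -bE xa leqNgt.
  by rewrite (leq_trans lt_aB) ?Bmin.
apply: (minA (A :\ a)); first exact: properD1.
split; last 2 first.
- by apply: subset_trans AS; apply: subsetDl.
- by move=> s Ss; have [k k0 kB] := genB s Ss; apply: is_product_trans BA k0 kB.
have [b Bb] := set0Pn _ B0; have [k k0 [w wA _]] := BA b Bb.
apply/set0Pn; exists (tnth w (Ordinal k0)); apply: wA; exact: mem_tnth.
Qed.

Lemma min_rank_r S A : minimal_generating S A -> min_rank A = r S.
Proof.
move=> mA.
have [|[B mB rB] _] :=
    @leastP (fun k => exists2 B, minimal_generating S B & min_rank B = k).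
  by exists (min_rank A), A.
by apply/eqP; rewrite /r -rB eqn_leq (min_rank_le mA mB.1) (min_rank_le mB mA.1).
Qed.

End WellDefined.

(* Main.v *)
Require Import Defs.
From mathcomp Require Import all_boot all_order all_algebra.
From mathcomp Require Import boolp zify.
Import GRing.Theory Num.Theory.
Local Open Scope ring_scope.

(** Call [n - rank f] the defect of [f : PT n]. Composition is subadditive for
    the defect ([rank_mul_ge]): the part of the image of [g] lost in [f * g]
    comes from points outside the image of [f], of which there are
    [n - rank f]. Every factor taken from a minimal generating set has defect at
    most [n - r S], so a product of [k] generators has defect at most
    [k * (n - r S)] ([rank_prod_ge]). An element of the kernel has defect
    [n - t S], hence [n - t S <= k * (n - r S)] whenever it is a product of [k]
    generators, and this is the bound.

    The convention that the identity has length [0] could break the argument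
    only if the identity belonged to the kernel. Then the kernel would be all
    of [S], i.e. [S] would be a finite simple monoid, and such a monoid is a
    group ([group_of_identity_in_kernel]), which is excluded. *)

Lemma rank_one (n : nat) : rank (1%g : PT n) = n.
Proof.
rewrite /rank -[RHS]card_ord -cardsT; congr #|pred_of_set _|.
by apply/setP=> y; rewrite !inE; apply/existsP; exists y; rewrite ffunE.
Qed.

(** Sylvester's rank inequality for partial transformations: [g] must take
    from outside the image of [f] all the points of the image of [g] that
    [f * g] misses. *)
Lemma rank_mul_ge {n : nat} (f g : PT n) :
  (rank f + rank g <= n + rank (f * g)%g)%N.
Proof.
pose im (h : PT n) := [set y : 'I_n | [exists x, h x == Some y]].
have lost : (#|im g :\: im (f * g)%g| <= #|~: im f|)%N.
  have inj : injective (@Some 'I_n) by move=> a b [].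
  rewrite -(card_imset (im g :\: im (f * g)%g) inj).
  apply: leq_trans (leq_imset_card (g : 'I_n -> option 'I_n) _).
  apply/subset_leq_card/subsetP=> z /imsetP[y + ->].
  rewrite !inE => /andP[/existsPn nfg /existsP[u /eqP gu]].
  rewrite -gu; apply: imset_f; rewrite !inE; apply/existsPn=> x.
  by apply/eqP=> fx; have := nfg x; rewrite ffunE fx /= gu eqxx.
have := cardsID (im (f * g)%g) (im g).
have := subset_leq_card (subsetIr (im g) (im (f * g)%g)).
have := cardsC (im f); rewrite card_ord.
rewrite /rank -!/(im _); lia.
Qed.

Lemma rank_prod_ge {n m : nat} (w : seq (PT n)) :
  {in w, forall a, (m <= rank a)%N} ->
  (n <= rank (\prod_(a <- w) a)%g + size w * (n - m))%N.
Proof.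
elim: w => [|a w IH] hw; first by rewrite big_nil rank_one; lia.
have ma := hw a (mem_head _ _).
have {}IH := IH (sub_in1 (@mem_behead _ (a :: w)) hw).
have := rank_mul_ge a (\prod_(b <- w) b)%g.
rewrite big_cons /= mulSn; set P := (\prod_(b <- w) b)%g in IH *.
move: (rank P) (rank (a * P)%g) IH => p q; lia.
Qed.

Section SimpleMonoid.
Context {n : nat}.
Implicit Types (S : {set PT n}) (e s : PT n).
Local Open Scope group_scope.

Lemma ideal_generated {S s} : subsemigroup S -> s \in S ->
  ideal S [set x * s * y | x : PT n in S, y : PT n in S].
Proof.
move=> [S0 Sm] Ss; split.
- by apply/set0Pn; exists (s * s * s); apply/imset2P; exists s s.
- by apply/subsetP=> _ /imset2P[x y Sx Sy ->]; rewrite !Sm.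
move=> _ v /imset2P[x y Sx Sy ->] Sv; split; apply/imset2P.
- by exists x (y * v); rewrite ?Sm // !mulgA.
- by exists (v * x) y; rewrite ?Sm // !mulgA.
Qed.

(** In a finite monoid, one-sided inverses are two-sided: left translation by
    [z] is injective, hence surjective. *)
Lemma right_invertible_of_left {S e x z} : subsemigroup S -> is_identity S e ->
  x \in S -> z \in S -> x * z = e -> exists2 u, u \in S & z * u = e.
Proof.
move=> [_ Sm] [Se e1] Sx Sz xz.
have inj : {in S &, injective (fun u => z * u)}.
  move=> u v Su Sv /(congr1 (fun b => x * b)).
  by rewrite !mulgA xz; have [-> _] := e1 u Su; have [-> _] := e1 v Sv.
have : [set z * u | u : PT n in S] = S.
  apply/eqP; rewrite eqEcard (card_in_imset inj) leqnn andbT.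
  by apply/subsetP=> _ /imsetP[u Su ->]; rewrite Sm.
by move/setP/(_ e); rewrite Se => /imsetP[u Su ->]; exists u.
Qed.

(** The two-sided ideal generated by any [s] contains the kernel, hence the
    identity: [e = x * s * y]. Finiteness turns this into a right inverse of
    [s], and a monoid with right inverses is a group. *)
Lemma group_of_identity_in_kernel {S e} :
  subsemigroup S -> is_identity S e -> e \in kernel S -> is_group S.
Proof.
move=> sS idS Ke; have [_ Sm] := sS; have [Se e1] := idS.
have rinv : {in S, forall s, exists2 v, v \in S & s * v = e}.
  move=> s Ss.
  have /imset2P[x y Sx Sy exsy] :=
    subsetP (kernel_min (ideal_generated sS Ss)) e Ke.
  have [|u Su syu] := right_invertible_of_left sS idS Sx (Sm _ _ Ss Sy).
    by rewrite mulgA -exsy.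
  by exists (y * u); rewrite ?Sm // mulgA.
split=> //; exists e => // s Ss.
have [v Sv sv] := rinv s Ss; have [w Sw vw] := rinv v Sv.
exists v => //; split=> //.
have [_ se] := e1 s Ss; have [ew _] := e1 w Sw.
by have -> : s = w by rewrite -se -vw mulgA sv.
Qed.

End SimpleMonoid.

(** The minima in the definitions of [N' S], [N S A] and of the length are all
    taken over nonempty sets, hence attained; the length is not given by the
    convention on the identity since [S] is not a group. *)
Lemma kernel_product_of_N' {n : nat} {S : {set PT n}} :
  subsemigroup S -> ~ is_group S ->
  exists A s, [/\ minimal_generating S A, s \in kernel S &
                  is_product A (N' S) s].
Proof.
move=> sS nG; have [B mB] := minimal_generating_exists sS.
have [K0 KS _] := kernel_ideal sS; have [s0 Ks0] := set0Pn _ K0.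
have [|[A mA NA] _] :=
    @leastP (fun k => exists2 A, minimal_generating S A & N S A = k).
  by exists (N S B), B.
have [|[s Ks ls] _] :=
    @leastP (fun k => exists2 s, s \in kernel S & length S A s = k).
  by exists (length S A s0), s0.
exists A, s; split=> //; rewrite /N' -NA /N -ls /length.
have -> : `[< is_identity S s >] = false.
  by apply/asboolPn=> ids; apply: nG; apply: group_of_identity_in_kernel Ks.
have [[_ _ genA] _] := mA.
have [k k0 kA] := genA s (subsetP KS s Ks).
by have [|[]] := @leastP (fun k => (0 < k)%N /\ is_product A k s); first by exists k.
Qed.

Theorem theorem3p11 (n : nat) (S : {set PT n})
    (hn : (1 <= n)%N) (hS : subsemigroup S) (hG : ~ is_group S)
    (hr : (r S <= n - 1)%N) :
  Num.ceil ((n%:R - (t S)%:R) / (n%:R - (r S)%:R) : rat) <= (N' S)%:Z.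
Proof.
have [A [s [mA Ks [w wA sE]]]] := kernel_product_of_N' hS hG.
have [A0 _ _] := mA.1; have [_ rA] := min_rankP A0.
have bound : (n <= t S + N' S * (n - r S))%N.
  rewrite -(rank_kernel hS Ks) sE -{2}(size_tuple w).
  by apply: rank_prod_ge => a /wA /rA; rewrite (min_rank_r mA).
have rn : (r S < n)%N by lia.
rewrite ceil_le_int ler_pdivrMr; last by rewrite subr_gt0 ltr_nat.
rewrite lerBlDl -(natrB _ (ltnW rn)) -pmulrn -natrM -natrD ler_nat.
exact: bound.
Qed.
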